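(* Let $n\ge 1$ be an integer and let $\mathcal F\subset\binom{[n]}{3}$ be shifted and have property $U(3,7)$, i.e. $|F_1\cup F_2\cup F_3|\le 7$ for all $F_1,F_2,F_3\in\mathcal F$. Let $\mathcal F_1:=\mathcal A(1,1,n,3)$, $\mathcal F_2:=\mathcal A(4,2,n,3)$, $\mathcal F_3:=\mathcal A(7,3,n,3)$. Then $|\mathcal F|<\max_{i\in[3]}|\mathcal F_i|$, unless $\mathcal F\in\{\mathcal F_1,\mathcal F_2,\mathcal F_3\}$.
   Context: For integers $p\ge r\ge 0$, $\mathcal A(p,r,n,k):=\{A\in\binom{[n]}{k}:|A\cap[p]|\ge r\}$. For $F=\{a_1<\ldots<a_k\}$ and $G=\{b_1<\ldots<b_k\}$ write $G\prec_s F$ if $b_j\le a_j$ for all $j$. A family $\mathcal F\subset\binom{[n]}{k}$ is shifted if $F\in\mathcal F$ and $G\prec_s F$ imply $G\in\mathcal F$. The sets $F_i$ need not be distinct. *)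

(* Defs.v *)
From mathcomp Require Import all_boot.

Set Implicit Arguments.
Unset Strict Implicit.
Unset Printing Implicit Defensive.

(* The ground set [n] = {1, ..., n} is represented by 'I_n, the ordinal i
   standing for the integer i.+1. *)

Definition ksets (n k : nat) : {set {set 'I_n}} :=
  [set A : {set 'I_n} | #|A| == k].

(* [p] as a subset of [n]; it is all of [n] when p >= n. *)
Definition initseg (n p : nat) : {set 'I_n} := [set i : 'I_n | i < p].

Definition frankl (p r n k : nat) : {set {set 'I_n}} :=
  [set A in ksets n k | r <= #|A :&: initseg n p|].

Definition increasing_elements (n : nat) (A : {set 'I_n}) : seq nat :=
  sort leq [seq val i | i <- enum A].

(* all2 is false on sequences of different lengths, so this entails
   #|G| = #|F|. *)
Definition shift_le (n : nat) (G F : {set 'I_n}) : bool :=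
  all2 leq (increasing_elements G) (increasing_elements F).

Definition shifted (n : nat) (FF : {set {set 'I_n}}) : Prop :=
  forall F G : {set 'I_n}, F \in FF -> shift_le G F -> G \in FF.

Definition property_U37 (n : nat) (FF : {set {set 'I_n}}) : Prop :=
  forall F1 F2 F3 : {set 'I_n},
    F1 \in FF -> F2 \in FF -> F3 \in FF -> #|F1 :|: F2 :|: F3| <= 7.

(* Main.v *)
Require Import Defs.
From mathcomp Require Import all_boot zify.

Set Implicit Arguments.
Unset Strict Implicit.
Unset Printing Implicit Defensive.

(** Elements are numbered from 0.  A shifted family included in none of
    [frankl 1 1], [frankl 4 2], [frankl 7 3] contains {1,2,3}, {0,4,5} and
    {0,1,7}.  Together with U(3,7) these three sets rule out {0,6,7}, {2,3,6}
    and {0,5,8}, and, according to which of {0,3,7}, {1,2,7} belong to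
    the family, one or two further sets.  By shiftedness everything above an excluded
    set is excluded too, which leaves at most 34 triples below 9 and at most
    5 triples with any given largest element c >= 9.  Now 34 + 5 (n - 9) is less
    than 35 for n <= 9 and less than 6 n - 20 = #|frankl 4 2 n 3| for n >= 10. *)

(** * Sets of ordinals coded as strictly increasing sequences of naturals *)

Section IncreasingElements.
Variable n : nat.
Implicit Types A B : {set 'I_n}.

Lemma perm_increasing_elements A :
  perm_eq (increasing_elements A) [seq val i | i <- enum A].
Proof. by rewrite perm_sort. Qed.

Lemma mem_increasing_elements A (i : 'I_n) :
  (val i \in increasing_elements A) = (i \in A).
Proof.
by rewrite (perm_mem (perm_increasing_elements A)) mem_map ?mem_enum //; apply: val_inj.
Qed.

Lemma increasing_elements_lt A : all (fun x => x < n) (increasing_elements A).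
Proof.
rewrite (perm_all _ (perm_increasing_elements A)).
by apply/allP => _ /mapP[i _ ->]; apply: ltn_ord.
Qed.

Lemma size_increasing_elements A : size (increasing_elements A) = #|A|.
Proof. by rewrite size_sort size_map cardE. Qed.

Lemma increasing_elements_sorted A : sorted ltn (increasing_elements A).
Proof.
rewrite ltn_sorted_uniq_leq sort_sorted; last exact: leq_total.
by rewrite sort_uniq map_inj_uniq ?enum_uniq //; apply: val_inj.
Qed.

Lemma increasing_elements_uniq A : uniq (increasing_elements A).
Proof. exact: (sorted_uniq ltn_trans ltnn (increasing_elements_sorted A)). Qed.

Lemma increasing_elements_inj : injective (@increasing_elements n).
Proof.
by move=> A B eqAB; apply/setP => i; rewrite -!mem_increasing_elements eqAB.
Qed.

Lemma card_increasing_elementsI A p :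
  #|A :&: initseg n p| = count (fun x => x < p) (increasing_elements A).
Proof.
have /seq.permP -> := perm_increasing_elements A.
rewrite count_map -size_filter cardE /enum_mem.
congr size; rewrite -filter_predI; apply: eq_filter => i.
by rewrite /= !inE andbC.
Qed.

(** Carries U(3,7) over to sequences, where unions of explicit triples are evaluated by
    computation. *)
Lemma card_setU3 A B (C : {set 'I_n}) :
  #|A :|: B :|: C| = size (undup (increasing_elements A ++ increasing_elements B
                                  ++ increasing_elements C)).
Proof.
rewrite -size_increasing_elements; apply/perm_size/uniq_perm.
- exact: increasing_elements_uniq.
- exact: undup_uniq.
move=> x; rewrite mem_undup !mem_cat.
have [ltxn|lenx] := ltnP x n.
  by rewrite -[x]/(val (Ordinal ltxn)) !mem_increasing_elements !inE orbA.
have out (D : {set 'I_n}) : (x \in increasing_elements D) = false.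
  by apply/negP => /(allP (increasing_elements_lt D)); rewrite ltnNge lenx.
by rewrite !out.
Qed.

Definition set_of_seq (s : seq nat) : {set 'I_n} := [set i : 'I_n | val i \in s].

Lemma set_of_seqK s : sorted ltn s -> all (fun x => x < n) s ->
  increasing_elements (set_of_seq s) = s.
Proof.
move=> s_sorted s_lt.
apply: (irr_sorted_eq ltn_trans ltnn (increasing_elements_sorted _) s_sorted) => x.
have [ltxn|lenx] := ltnP x n.
  by rewrite -[x]/(val (Ordinal ltxn)) mem_increasing_elements inE.
apply/idP/idP => [/(allP (increasing_elements_lt _))|/(allP s_lt)];
  by rewrite ltnNge lenx.
Qed.

(** By [set_of_seqK] distinct increasing sequences code distinct sets, so an explicit list of codes
    bounds the family from below. *)
Lemma frankl_size_ge p r k (L : seq (seq nat)) : uniq L ->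
    (forall s, s \in L -> [/\ sorted ltn s, all (fun x => x < n) s, size s = k &
                              r <= count (fun x => x < p) s]) ->
  size L <= #|frankl p r n k|.
Proof.
move=> L_uniq LP; rewrite -(size_map set_of_seq) cardE.
apply: uniq_leq_size => [|_ /mapP[s sL ->]].
  rewrite map_inj_in_uniq // => s t /LP[s1 s2 _ _] /LP[t1 t2 _ _] eq_st.
  by rewrite -(set_of_seqK s1 s2) eq_st set_of_seqK.
have [s1 s2 sk sr] := LP s sL.
rewrite mem_enum inE inE -size_increasing_elements card_increasing_elementsI.
by rewrite set_of_seqK // sk eqxx.
Qed.

End IncreasingElements.

(** * Lower bounds for two of the extremal families *)

Definition triples m : seq (seq nat) :=
  [seq [:: p.1; p.2; c] | c <- iota 0 m, p <- [seq (a, b) | b <- iota 0 c, a <- iota 0 b]].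

Lemma mem_triples m a b c : a < b -> b < c -> c < m -> [:: a; b; c] \in triples m.
Proof.
move=> ab bc cm; apply/allpairsPdep; exists c, (a, b); split=> //.
  by rewrite mem_iota.
by apply/allpairsPdep; exists b, a; split=> //; rewrite mem_iota.
Qed.

Lemma leq_card_frankl73 n : 6 < n -> 35 <= #|frankl 7 3 n 3|.
Proof.
move=> n_gt6; apply: (@frankl_size_ge n 7 3 3 (triples 7)) => // s sT.
have : all (fun s => [&& sorted ltn s, all (fun x => x < 7) s, size s == 3 &
                        2 < count (fun x => x < 7) s]) (triples 7) by [].
move/allP/(_ s sT)/and4P => [-> /allP s_lt /eqP -> ->]; split=> //.
by apply/allP => x /s_lt x7; apply: leq_trans x7 n_gt6.
Qed.

Lemma leq_card_frankl42 n : 3 < n -> 6 * (n - 4) + 4 <= #|frankl 4 2 n 3|.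
Proof.
move=> n_gt3.
(* [L] lists the triples with exactly two elements below 4; [triples 4] adds the four lying entirely
   below 4. *)
pose P := [:: [:: 0; 1]; [:: 0; 2]; [:: 0; 3]; [:: 1; 2]; [:: 1; 3]; [:: 2; 3]].
pose L := [seq rcons e c | e <- P, c <- iota 4 (n - 4)].
have LP s : s \in L -> exists a b c,
    [/\ s = [:: a; b; c], a < b, b < 4, 4 <= c & c < n].
  case/allpairsP => -[e c] /= []; rewrite mem_iota subnKC // => eP /andP[c4 cn] ->.
  move: eP; rewrite !inE.
  by do 5?case/orP; move/eqP->; rewrite /=; do 3!eexists; split.
have -> : 6 * (n - 4) + 4 = size (L ++ triples 4).
  by rewrite size_cat size_allpairs size_iota.
apply: frankl_size_ge => [|s].
  rewrite cat_uniq; apply/and3P; split=> //.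
  - apply: allpairs_uniq; rewrite ?iota_uniq //.
    by move=> [e c] [e' c'] _ _ /= /rcons_inj[-> ->].
  - apply/hasPn => s sT; apply/negP => /LP[a [b [c [s_abc _ _ c4 _]]]].
    rewrite s_abc in sT; have : all (all (fun x => x < 4)) (triples 4) by [].
    by move/allP/(_ _ sT); rewrite /= [c < 4]ltnNge c4 !andbF.
rewrite mem_cat => /orP[/LP[a [b [c [-> ab b4 c4 cn]]]]|sT].
  by split=> //=; lia.
have : all (fun s => [&& sorted ltn s, all (fun x => x < 4) s, size s == 3 &
                        1 < count (fun x => x < 4) s]) (triples 4) by [].
move/allP/(_ s sT)/and4P => [-> /allP s_lt /eqP -> ->]; split=> //.
by apply/allP => x /s_lt x4; apply: leq_trans x4 n_gt3.
Qed.

(** * Upper bound for a shifted family from excluded triples *)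

Definition avoids (gens : seq (seq nat)) (s : seq nat) : bool :=
  ~~ has (fun g => all2 leq g s) gens.

Section ShiftedTriples.
Variables (n : nat) (S : seq (seq nat)).
Hypothesis S_uniq : uniq S.
Hypothesis S_triple : forall s, s \in S ->
  [/\ sorted ltn s, all (fun x => x < n) s & size s = 3].
Hypothesis S_shifted : forall s t, t \in S -> sorted ltn s -> all2 leq s t -> s \in S.

Lemma triple_ind (Q : seq nat -> Prop) :
    (forall a b c, a < b -> b < c -> c < n -> [:: a; b; c] \in S -> Q [:: a; b; c]) ->
  forall s, s \in S -> Q s.
Proof.
move=> QP s sS; have [] := S_triple sS.
case: s sS => [|a [|b [|c []]]] //= sS.
by rewrite andbT => /andP[ab bc] /and4P[_ _ cn _] _; apply: QP.
Qed.

Lemma notin_avoids gens s : all (sorted ltn) gens -> all [predC S] gens ->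
  s \in S -> avoids gens s.
Proof.
move=> /allP gsort /allP gS sS; apply/hasPn => g gG; apply/negP => gs.
by move: (gS _ gG); rewrite inE /= (S_shifted sS (gsort _ gG) gs).
Qed.

(** Members below 9 are counted by [k]. A member {a,b,c} with c >= 9 is recovered from c and
    {a,b,8}, which still avoids [gens]; so each such c contributes at most [m]. *)
Lemma size_avoiding (gens : seq (seq nat)) k m :
    [:: 0; 5; 8] \in gens -> all (sorted ltn) gens -> all [predC S] gens ->
    size [seq s <- triples 9 | avoids gens s] <= k ->
    size [seq s <- triples 9 | avoids gens s && (nth 0 s 2 == 8)] <= m ->
  size S <= k + m * (n - 9).
Proof.
move=> g058 gsort gS le_k le_m.
pose top := [seq s <- triples 9 | avoids gens s && (nth 0 s 2 == 8)].
pose L := [seq s <- triples 9 | avoids gens s] ++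
          [seq rcons (take 2 s) c | s <- top, c <- iota 9 (n - 9)].
apply: (@leq_trans (size L)); last first.
  by rewrite size_cat size_allpairs size_iota leq_add // leq_mul2r le_m orbT.
apply: uniq_leq_size => // s; elim/triple_ind => a b c ab bc cn sS.
have avs := notin_avoids gsort gS sS.
rewrite mem_cat mem_filter avs; have [c9|c9] := ltnP c 9; first by rewrite mem_triples.
(* Otherwise {0,5,8} would lie below {a,b,c}. In particular b < 8, so {a,b,8} is a genuine
   triple. *)
have b5 : b < 5.
  rewrite ltnNge; apply/negP => b5; move/hasPn: avs => /(_ _ g058) /=.
  by rewrite b5 (ltnW c9).
apply/orP; right; apply/allpairsP; exists ([:: a; b; 8], c); split=> //=; last first.
  by rewrite mem_iota; lia.
rewrite mem_filter mem_triples ?eqxx ?andbT //; last exact: leq_trans b5 _.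
(* A generator below {a,b,8} is also below {a,b,c}, since 8 < c. *)
apply/hasPn => g gG; apply: contra (hasPn avs g gG).
case: g {gG} => [|x [|y [|z []]]] //=; rewrite ?andbF //.
by move=> /and4P[-> -> z8 _]; rewrite andbT (leq_trans z8) // ltnW.
Qed.

Hypothesis S_U37 : forall s t u, s \in S -> t \in S -> u \in S ->
  size (undup (s ++ t ++ u)) <= 7.
Hypotheses (S123 : [:: 1; 2; 3] \in S) (S045 : [:: 0; 4; 5] \in S)
           (S017 : [:: 0; 1; 7] \in S).

Lemma notin_U37 s t u : s \in S -> t \in S ->
  7 < size (undup (s ++ t ++ u)) -> u \notin S.
Proof. by move=> sS tS; rewrite ltnNge; apply: contra; apply: S_U37. Qed.

Lemma size_shifted_triples : size S <= 34 + 5 * (n - 9).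
Proof.
(* Each exclusion by [notin_U37] comes from three triples covering all of 0, ..., 7. *)
have N067 : [:: 0; 6; 7] \notin S by apply: (notin_U37 S123 S045).
have N236 : [:: 2; 3; 6] \notin S by apply: (notin_U37 S045 S017).
have N058 : [:: 0; 5; 8] \notin S.
  (* The union of {1,2,3}, {0,4,7} and {0,5,8} has eight elements: only 6 is missing from 0, ...,
     8. *)
  apply/negP => S058; have S047 : [:: 0; 4; 7] \in S by apply: S_shifted S058 _ _.
  by have := S_U37 S123 S047 S058.
(* The three cases leave 34, 29 and 33 triples below 9, of which 4, 3 and 2 have largest element
   8. *)
have [S037|N037] := boolP ([:: 0; 3; 7] \in S).
  have N126 : [:: 1; 2; 6] \notin S by apply: (notin_U37 S045 S037).
  apply: (@size_avoiding [:: [:: 0; 5; 8]; [:: 0; 6; 7]; [:: 2; 3; 6]; [:: 1; 2; 6]]) => //.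
  by rewrite /= N058 N067 N236 N126.
have [S127|N127] := boolP ([:: 1; 2; 7] \in S).
  have N036 : [:: 0; 3; 6] \notin S by apply: (notin_U37 S045 S127).
  apply: (@size_avoiding [:: [:: 0; 5; 8]; [:: 0; 6; 7]; [:: 2; 3; 6]; [:: 0; 3; 6]]) => //.
  by rewrite /= N058 N067 N236 N036.
apply: (@size_avoiding [:: [:: 0; 5; 8]; [:: 0; 6; 7]; [:: 2; 3; 6]; [:: 0; 3; 7];
                          [:: 1; 2; 7]]) => //.
by rewrite /= N058 N067 N236 N037 N127.
Qed.

End ShiftedTriples.

Lemma notin_frankl n p r (A : {set 'I_n}) : #|A| = 3 -> A \notin frankl p r n 3 ->
  exists a b c, [/\ increasing_elements A = [:: a; b; c], a < b, b < c &
                    (a < p) + ((b < p) + (c < p)) < r].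
Proof.
move=> A3; rewrite !inE A3 /= -ltnNge card_increasing_elementsI.
have := increasing_elements_sorted A; have := size_increasing_elements A; rewrite A3.
case: increasing_elements => [|a [|b [|c []]]] //= _.
by rewrite andbT addn0 => /andP[ab bc] lt_r; exists a, b, c.
Qed.

Theorem theorem8 (n : nat) (FF : {set {set 'I_n}}) :
  1 <= n ->
  FF \subset ksets n 3 ->
  shifted FF ->
  property_U37 FF ->
  FF \notin [:: frankl 1 1 n 3; frankl 4 2 n 3; frankl 7 3 n 3] ->
  #|FF| < maxn #|frankl 1 1 n 3| (maxn #|frankl 4 2 n 3| #|frankl 7 3 n 3|).
Proof.
move=> _ /subsetP FF3 FFs FFU; rewrite !inE !negb_or => /and3P[ne1 ne2 ne3].
have FFcard A : A \in FF -> #|A| = 3 by move/FF3; rewrite inE => /eqP.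
rewrite !leq_max.
have [sub1|/subsetPn[A1 A1F A1N]] := boolP (FF \subset frankl 1 1 n 3).
  by rewrite proper_card // properEneq ne1.
have [sub2|/subsetPn[A2 A2F A2N]] := boolP (FF \subset frankl 4 2 n 3).
  by rewrite (@proper_card _ FF (frankl 4 2 n 3)) ?orbT // properEneq ne2.
have [sub3|/subsetPn[A3 A3F A3N]] := boolP (FF \subset frankl 7 3 n 3).
  by rewrite (@proper_card _ FF (frankl 7 3 n 3)) ?orbT // properEneq ne3.
pose S := [seq increasing_elements A | A <- enum FF].
have memS A : A \in FF -> increasing_elements A \in S.
  by move=> AF; apply: map_f; rewrite mem_enum.
have S_uniq : uniq S by rewrite map_inj_uniq ?enum_uniq //; apply: increasing_elements_inj.
have S_triple s : s \in S -> [/\ sorted ltn s, all (fun x => x < n) s & size s = 3].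
  case/mapP => A; rewrite mem_enum => AF ->.
  rewrite increasing_elements_sorted increasing_elements_lt size_increasing_elements.
  by rewrite FFcard.
have S_shifted s t : t \in S -> sorted ltn s -> all2 leq s t -> s \in S.
  case/mapP => A; rewrite mem_enum => AF -> s_sorted le_sA.
  (* A sequence dominated by the elements of [A] stays below [n], so it codes a set to which
     [shifted] applies. *)
  have s_lt : all (fun x => x < n) s.
    elim: s (increasing_elements A) (increasing_elements_lt A) le_sA {s_sorted} =>
      [|x s IHs] [|y u] //= /andP[yn un] /andP[xy su].
    by rewrite (leq_ltn_trans xy yn) (IHs u).
  rewrite -(set_of_seqK s_sorted s_lt); apply/memS/(FFs A) => //.
  by rewrite /shift_le set_of_seqK.
have S_U37 s t u : s \in S -> t \in S -> u \in S -> size (undup (s ++ t ++ u)) <= 7.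
  case/mapP => A + -> /mapP[B + ->] /mapP[C + ->].
  by rewrite !mem_enum -card_setU3; apply: FFU.
have [a1 [b1 [c1 [e1 ab1 bc1 l1]]]] := notin_frankl (FFcard _ A1F) A1N.
have [a2 [b2 [c2 [e2 ab2 bc2 l2]]]] := notin_frankl (FFcard _ A2F) A2N.
have [a3 [b3 [c3 [e3 ab3 bc3 l3]]]] := notin_frankl (FFcard _ A3F) A3N.
(* [A1] misses 0, so a1 >= 1; [A2] has at most one element below 4, so b2 >= 4; [A3] has an element
   outside 0, ..., 6, so c3 >= 7. Strict increase bounds the other entries, and shifting down gives
   the three triples. *)
have S123 : [:: 1; 2; 3] \in S.
  by apply: S_shifted (memS _ A1F) _ _ => //; rewrite e1 /=; clear -ab1 bc1 l1; lia.
have S045 : [:: 0; 4; 5] \in S.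
  by apply: S_shifted (memS _ A2F) _ _ => //; rewrite e2 /=; clear -ab2 bc2 l2; lia.
have S017 : [:: 0; 1; 7] \in S.
  by apply: S_shifted (memS _ A3F) _ _ => //; rewrite e3 /=; clear -ab3 bc3 l3; lia.
have n_gt7 : 7 < n by have [_ /and4P[]] := S_triple _ S017.
have := size_shifted_triples S_uniq S_triple S_shifted S_U37 S123 S045 S017.
rewrite size_map -cardE => le_FF.
have le73 := leq_card_frankl73 (ltnW n_gt7).
have le42 := leq_card_frankl42 (ltn_trans (isT : 3 < 7) n_gt7).
(* For n <= 9 the truncated difference [n - 9] is 0 and 34 < 35; beyond that, 34 + 5 (n - 9) < 6 (n
   - 4) + 4 amounts to n > 9. *)
have [n9|n9] := leqP n 9.
  apply/orP; right; apply/orP; right; apply: leq_trans le73.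
  by move: le_FF; rewrite (eqP (_ : n - 9 == 0)).
apply/orP; right; apply/orP; left; apply: leq_trans le42.
apply: leq_ltn_trans le_FF _; clear -n9; lia.
Qed.
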